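(* Let $q\ge2$ be an integer and let $\{X_n\}_{n\ge1}$ be a stochastic process with state space $\{0,\ldots,q-1\}$ (not assumed stationary). Let $X=\sum_{n=1}^\infty X_nq^{-n}$ and $F(x)=\mathrm P(X\le x)$. For any $x=(0.x_1x_2\ldots)_q\in[0,1]$, where the non-terminating expansion is chosen if $x\in\mathbb Q_q$, we have $$F(x)=\sum_{n\ge1:\,x_n\ge1}\ \sum_{k=0}^{x_n-1}p(x_1,\ldots,x_{n-1},k)+\mathrm P(X=x)$$ (with $p(x_1,\ldots,x_{n-1},k)=p(k)$ if $n=1$). If in addition $q=2$ and $y$ is the point configuration corresponding to $x$, then $$F(x)=\sum_{n\in y}\mathrm P(Y_{n-1}=y_{n-1},\ n\notin Y)+\mathrm P(X=x).$$
   Context: $\mathbb N=\{1,2,\ldots\}$. The finite dimensional probabilities are $p(x_1,\ldots,x_n)=\mathrm P(X_1=x_1,\ldots,X_n=x_n)$ for $n\in\mathbb N$ and $x_1,\ldots,x_n\in\{0,\ldots,q-1\}$. For digits $x_n\in\{0,\ldots,q-1\}$, $(0.x_1x_2\ldots)_q=\sum_{n=1}^\infty x_nq^{-n}$. $\mathbb Q_q$ is the set of base-$q$ fractions in $(0,1)$, i.e. numbers $(0.x_1\ldots x_n00\ldots)_q$ with $n\in\mathbb N$ and $x_n>0$; such a number also has the non-terminating expansion $(0.x_1\ldots x_{n-1}(x_n-1)(q-1)(q-1)\ldots)_q$. All other $x\in[0,1]$ have a unique base-$q$ expansion. When $q=2$: the point configuration corresponding to $x=(0.x_1x_2\ldots)_2$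 (for the chosen expansion) is $y=\{n\in\mathbb N\mid x_n=1\}$, the point process corresponding to $\{X_n\}$ is $Y=\{n\in\mathbb N\mid X_n=1\}$, and $y_0=Y_0=\emptyset$, $y_n=y\cap\{1,\ldots,n\}$, $Y_n=Y\cap\{1,\ldots,n\}$ for $n\in\mathbb N$. *)

(* Defs.v *)
From HB Require Import structures.
From mathcomp Require Import all_boot all_order all_algebra.
From mathcomp Require Import all_classical all_reals all_analysis.

Set Implicit Arguments.
Unset Strict Implicit.
Unset Printing Implicit Defensive.

Import Order.TTheory GRing.Theory Num.Theory numFieldNormedType.Exports.

Local Open Scope classical_set_scope.
Local Open Scope ring_scope.

(* Sequences are indexed by {1, 2, ...}: a sequence is a function on nat whose
   value at 0 is never used. *)

Definition digits (q : nat) (a : nat -> nat) : Prop :=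
  forall n, (0 < n)%N -> (a n < q)%N.

(* (0.a_1 a_2 ...)_q *)
Definition expansion_value (R : realType) (q : nat) (a : nat -> nat) : R :=
  limn (fun N => \sum_(1 <= n < N) (a n)%:R * (q%:R : R) ^- n).

Definition terminating (a : nat -> nat) : Prop :=
  exists N, forall n, (N < n)%N -> a n = 0%N.

Definition base_fractions (R : realType) (q : nat) : set R :=
  [set x : R | exists (n : nat) (c : nat -> nat),
    [/\ (0 < n)%N, digits q c, (0 < c n)%N,
        forall i, (n < i)%N -> c i = 0%N & x = expansion_value R q c]].

Section process.
Context d (T : measurableType d) (R : realType) (P : probability T R).
Variable X : nat -> {RV P >-> nat}.

(* p(s_1, ..., s_n) with n = size s; s is indexed from 0, hence the shift. *)
Definition fidi_prob (s : seq nat) : \bar R :=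
  P [set t | forall i, (i < size s)%N -> X i.+1 t = nth 0%N s i].

Definition process_value (q : nat) (t : T) : R :=
  expansion_value R q (fun n => X n t).

Definition process_cdf (q : nat) (x : R) : \bar R :=
  P [set t | process_value q t <= x].

End process.

Arguments base_fractions : clear implicits.

Definition point_configuration (a : nat -> nat) : set nat :=
  [set n | (0 < n)%N /\ a n = 1%N].

Definition config_upto (A : set nat) (n : nat) : set nat :=
  A `&` [set k | (1 <= k <= n)%N].

(* Main.v *)
(** Two digit sequences are compared at the first index where they differ: the
    digits beyond position [n] contribute at most [q^-n], so the smaller digit
    there gives an expansion at most as large, and strictly smaller when the
    larger sequence has a nonzero digit further on. Hence [X < x] is the disjoint
    union over [n] of the events "[X_n] first departs from [x_n], and downwards",
    and each of these splits according to the value of [X_n]. *)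
Require Import Defs.
From HB Require Import structures.
From mathcomp Require Import all_boot all_order all_algebra.
From mathcomp Require Import all_classical all_reals all_analysis.
From mathcomp Require Import measurable_realfun zify lra.

Set Implicit Arguments.
Unset Strict Implicit.
Unset Printing Implicit Defensive.

Import Order.TTheory GRing.Theory Num.Theory numFieldNormedType.Exports.

Local Open Scope classical_set_scope.
Local Open Scope ring_scope.

(** * Base-[q] expansions and their lexicographic comparison *)

Section expansion.
Variables (R : realType) (q : nat).
Hypothesis hq : (2 <= q)%N.

Definition partial_value (a : nat -> nat) (N : nat) : R :=
  \sum_(1 <= n < N) (a n)%:R * (q%:R : R) ^- n.

Lemma partial_valueS a n : (0 < n)%N ->
  partial_value a n.+1 = partial_value a n + (a n)%:R * (q%:R : R) ^- n.
Proof. by move=> n0; rewrite /partial_value big_nat_recr. Qed.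

Lemma exprVn_gt0 n : 0 < (q%:R : R) ^- n.
Proof. by rewrite invr_gt0 exprn_gt0// ltr0n; lia. Qed.

Lemma partial_value_nondecreasing a : nondecreasing_seq (partial_value a).
Proof.
apply/nondecreasing_seqP => -[|n]; first by rewrite /partial_value !big_geq.
by rewrite [leRHS]partial_valueS// lerDl mulr_ge0// ltW// exprVn_gt0.
Qed.

(** Each digit is at most [q - 1], and [(q - 1) q^-(n+1) = q^-n - q^-(n+1)], so the bound on the
    added digits telescopes. *)
Lemma partial_value_add a m k : digits q a ->
  partial_value a (m + k).+1 <=
  partial_value a m.+1 + (q%:R ^- m - q%:R ^- (m + k)).
Proof.
move=> ha; elim: k => [|k IH]; first by rewrite addn0 subrr addr0.
rewrite addnS [leLHS]partial_valueS//; set n := (m + k)%N in IH *.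
have hn : (a n.+1)%:R <= q%:R - 1 :> R.
  by rewrite lerBrDr natr1 ler_nat ha.
have qq : (q%:R : R) ^- n = q%:R * q%:R ^- n.+1.
  by rewrite exprS invfM mulrA divff ?mul1r// pnatr_eq0; lia.
have := exprVn_gt0 n.+1; rewrite qq in IH * => h0.
have := ler_wpM2r (ltW h0) hn; rewrite mulrBl mul1r => h1.
lra.
Qed.

Lemma partial_value_cvg a : digits q a ->
  partial_value a @ \oo --> expansion_value R q a.
Proof.
move=> ha; apply: nondecreasing_is_cvgn; first exact: partial_value_nondecreasing.
(* The bound 1 is [q ^- 0], the case [m = 0] of [partial_value_add]. *)
exists 1 => _ [N _ <-].
apply: (@le_trans _ _ (partial_value a (0 + N).+1)).
  by apply: partial_value_nondecreasing; lia.
apply: (le_trans (partial_value_add 0 N ha)).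
by rewrite /partial_value big_geq// add0r expr0 invr1 gerBl ltW// exprVn_gt0.
Qed.

Lemma partial_value_le a N : digits q a ->
  partial_value a N <= expansion_value R q a.
Proof.
move=> ha; apply: nondecreasing_cvgn_le.
  exact: partial_value_nondecreasing.
exact: cvgP (partial_value_cvg ha).
Qed.

Lemma expansion_value_le a m : digits q a ->
  expansion_value R q a <= partial_value a m.+1 + q%:R ^- m.
Proof.
move=> ha; apply: limr_le; first exact: cvgP (partial_value_cvg ha).
near=> N; have mN : (m <= N)%N by near: N; exact: nbhs_infty_ge.
apply: (@le_trans _ _ (partial_value a (m + (N - m)).+1)).
  by apply: partial_value_nondecreasing; lia.
apply: (le_trans (partial_value_add m (N - m) ha)).
by rewrite lerD2l gerBl ltW// exprVn_gt0.
Unshelve. all: by end_near. Qed.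

Lemma expansion_value_gt a n k : digits q a -> (n < k)%N -> (0 < a k)%N ->
  partial_value a n.+1 < expansion_value R q a.
Proof.
move=> ha nk ak; apply: lt_le_trans (partial_value_le k.+1 ha).
apply: (@le_lt_trans _ _ (partial_value a k)).
  exact: partial_value_nondecreasing.
by rewrite partial_valueS ?(leq_trans _ nk)// ltrDl mulr_gt0 ?ltr0n ?exprVn_gt0.
Qed.

Definition first_below (b a : nat -> nat) (n : nat) : Prop :=
  [/\ (0 < n)%N, forall i, (0 < i < n)%N -> b i = a i & (b n < a n)%N].

(** The tail of [b] beyond [n] is worth at most one unit of position [n], and [b n + 1 <= a n]
    absorbs that unit. *)
Lemma first_below_partial_value a b n : digits q b -> first_below b a n ->
  expansion_value R q b <= partial_value a n.+1.
Proof.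
move=> hb [n0 eqba ban]; apply: (le_trans (expansion_value_le n hb)).
rewrite !partial_valueS//.
have -> : partial_value b n = partial_value a n.
  by apply: eq_big_nat => i /eqba ->.
rewrite -addrA lerD2l -[X in _ + X <= _]mul1r -mulrDl.
by rewrite ler_wpM2r ?(ltW (exprVn_gt0 _))// natr1 ler_nat.
Qed.

Lemma first_below_le a b n : digits q a -> digits q b -> first_below b a n ->
  expansion_value R q b <= expansion_value R q a.
Proof.
move=> ha hb ban; apply: le_trans (partial_value_le n.+1 ha).
exact: first_below_partial_value.
Qed.

Lemma first_below_lt a b n : digits q a -> digits q b -> ~ terminating a ->
  first_below b a n -> expansion_value R q b < expansion_value R q a.
Proof.
move=> ha hb nta ban; apply: le_lt_trans (first_below_partial_value hb ban) _.
(* Without strict inequality, no digit of [a] beyond [n] can be nonzero, so [a] would terminate at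
   [n]. *)
apply: contrapT => nlt; apply: nta; exists n => k nk.
by apply: contrapT => /eqP; rewrite -lt0n => /(expansion_value_gt ha nk).
Qed.

Lemma first_below_trichotomy a b :
  (forall n, (0 < n)%N -> a n = b n) \/
  exists n, first_below a b n \/ first_below b a n.
Proof.
have [h|/existsNP[n hn]] := pselect (forall n, (0 < n)%N -> a n = b n).
  by left.
right; have exn : exists m, (0 < m)%N && (a m != b m).
  by exists n; move: hn => /not_implyP[-> /eqP].
have [m /andP[m0 abm] minm] := find_ex_minn exn.
have agree i : (0 < i < m)%N -> a i = b i.
  move=> /andP[i0 im]; apply: contrapT => /eqP abi.
  by have := minm i; rewrite i0 abi leqNgt im => /(_ isT).
exists m; move: abm; rewrite neq_ltn => /orP[lt|lt]; [left|right]; split=> //.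
by move=> i /agree.
Qed.

Lemma eq_expansion_value a b : (forall n, (0 < n)%N -> a n = b n) ->
  expansion_value R q a = expansion_value R q b.
Proof.
move=> eqab; congr (lim _); congr (_ @ \oo); apply/funext => N.
by apply: eq_big_nat => i /andP[i0 _]; rewrite eqab.
Qed.

(** The condition on [a] admits the zero sequence next to the non-terminating ones, since 0 has only
    that expansion. For it the right side fails because no digit lies below 0. *)
Lemma expansion_value_ltP a b : digits q a -> digits q b ->
    (terminating a -> forall n, (0 < n)%N -> a n = 0%N) ->
  expansion_value R q b < expansion_value R q a <->
  exists n, first_below b a n.
Proof.
move=> ha hb hnt; split=> [ltba|[n ban]]; last first.
  apply: (first_below_lt ha hb _ ban) => /hnt a0.
  by case: ban => n0 _; rewrite a0.
have [eqab|[n []]] := first_below_trichotomy a b.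
- by move: ltba; rewrite (eq_expansion_value eqab) ltxx.
- by move=> /(first_below_le hb ha); rewrite leNgt ltba.
- by move=> ban; exists n.
Qed.

Lemma terminating_base_fraction a : digits q a -> terminating a ->
  (exists2 n, (0 < n)%N & a n != 0%N) ->
  expansion_value R q a \in base_fractions R q.
Proof.
move=> ha [N aN] [n n0 an]; apply/mem_set.
have exn : exists m, (0 < m)%N && (a m != 0%N) by exists n; rewrite n0.
have ubn m : (0 < m)%N && (a m != 0%N) -> (m <= N)%N.
  by move=> /andP[_]; apply: contraNT; rewrite -ltnNge => /aN ->.
(* [m] is the position of the last nonzero digit, as the definition of a base-[q] fraction asks. *)
have [m /andP[m0 am] maxm] := ex_maxnP exn ubn.
exists m, a; split=> //; first by rewrite lt0n.
move=> i mi; apply/eqP; apply: contraTT mi => ai.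
rewrite -leqNgt; have [->//|i0] := posnP i.
by apply: maxm; rewrite i0.
Qed.

End expansion.

Local Open Scope ereal_scope.

(** * Events of first departure and their probabilities *)

Section process.
Context d (T : measurableType d) (R : realType) (P : probability T R).
Variables (X : nat -> {RV P >-> nat}) (q : nat).

Lemma measurable_RV_preimage n (A : set nat) : measurable [set t | A (X n t)].
Proof. by rewrite -[X in measurable X]setTI; apply: measurable_funPT. Qed.

Lemma measurable_agree a n :
  measurable [set t | forall i, (0 < i < n)%N -> X i t = a i].
Proof.
rewrite (_ : mkset _ = \bigcap_(i in [set i | (0 < i < n)%N])
    [set t | X i t = a i]); last by apply/seteqP; split=> t h i; apply: h.
by apply: bigcap_measurableType => i _; exact: (measurable_RV_preimage i [set a i]).
Qed.

Lemma measurable_first_below a n :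
  measurable [set t | first_below (fun i => X i t) a n].
Proof.
have [->|n0] := posnP n.
  by rewrite (_ : mkset _ = set0)//; apply/seteqP; split=> t [].
rewrite (_ : mkset _ = [set t | forall i, (0 < i < n)%N -> X i t = a i] `&`
    [set t | [set k | (k < a n)%N] (X n t)]).
  by apply: measurableI; [exact: measurable_agree|exact: measurable_RV_preimage].
by apply/seteqP; split=> t [].
Qed.

(** With two departure indices, the agreement required before the later one contradicts the strict
    inequality at the earlier one. *)
Lemma trivIset_first_below a (D : set nat) :
  trivIset D (fun n => [set t | first_below (fun i => X i t) a n]).
Proof.
move=> n m _ _ [t [[n0 an ltn] [m0 am ltm]]]; apply/eqP; apply: contraT.
rewrite neq_ltn => /orP[nm|mn].
- by move: ltn; rewrite am ?n0 ?nm// ltnn.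
- by move: ltm; rewrite an ?m0 ?mn// ltnn.
Qed.

Lemma measurable_process_value : (2 <= q)%N ->
  (forall t, digits q (fun n => X n t)) ->
  measurable_fun setT (process_value X q : T -> R).
Proof.
move=> hq hX.
apply: (@measurable_fun_cvg _ _ _ _
  (fun N t => partial_value R q (fun n => X n t) N)); last first.
  by move=> t _; exact: partial_value_cvg.
move=> N; apply: measurable_sum => n.
apply: measurable_funM => //.
exact: (@measurableT_comp _ _ _ _ _ _ (fun k : nat => k%:R : R)).
Qed.

(** Restricting to [1 <= a n] loses no event, as nothing lies below a digit 0. The index set has the
    shape that the series of the theorem takes once its lower bound joins its condition. *)
Lemma process_cdfE (a : nat -> nat) : (2 <= q)%N ->
    (forall t, digits q (fun n => X n t)) -> digits q a ->
    (terminating a -> forall n, (0 < n)%N -> a n = 0%N) ->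
  process_cdf X q (expansion_value R q a) =
  \esum_(n in [set n | (1 <= a n)%N && (1 <= n)%N])
    P [set t | first_below (fun i => X i t) a n]
  + P [set t | process_value X q t = expansion_value R q a].
Proof.
move=> hq hX ha hnt; rewrite /process_cdf; set D := mkset (fun n => _ && _).
pose E n := [set t | first_below (fun i => X i t) a n].
have -> : [set t | (process_value X q t <= expansion_value R q a)%R] =
    \bigcup_(n in D) E n `|`
    [set t | process_value X q t = expansion_value R q a].
  apply/seteqP; split=> t /=.
    rewrite le_eqVlt => /orP[/eqP ->|]; first by right.
    move=> /(expansion_value_ltP R hq ha (hX t) hnt)[n ban]; left; exists n => //.
    by case: ban => n0 _ lt; rewrite /D/= n0 (leq_ltn_trans _ lt).
  case=> [[n _ En]|->//].
  by apply/ltW/(expansion_value_ltP R hq ha (hX t) hnt); exists n.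
have mE n : measurable (E n) by exact: measurable_first_below.
rewrite measureU; [|exact: bigcup_measurable| |].
(* [D] is put in terms of boolean membership, so that the unordered sum becomes the series of
   countable additivity. *)
- congr (_ + _); rewrite -[in RHS](set_mem_set D) -nneseries_esum//.
  apply: measure_bigcup => //; exact: trivIset_first_below.
- rewrite -[X in measurable X]setTI.
  exact: (measurable_process_value hq hX _ (measurable_set1 _)).
- apply/seteqP; split=> // t [[n _ En]] /= eqt.
  have /(expansion_value_ltP R hq ha (hX t) hnt) : exists n, E n t by exists n.
  by rewrite -eqt ltxx.
Qed.

(** Entry [i] of the word belongs to time [i.+1]: the prefix has length [n - 1], and the appended
    [k] is the value at time [n]. *)
Lemma fidi_prob_rcons (a : nat -> nat) n k : (0 < n)%N ->
  fidi_prob X (rcons [seq a i | i <- index_iota 1 n] k) =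
  P [set t | (forall i, (0 < i < n)%N -> X i t = a i) /\ X n t = k].
Proof.
case: n => // n _; rewrite /fidi_prob size_rcons size_map size_iota subn1 /=.
congr (P _); apply/seteqP; split=> t /= h.
  split=> [[//|i] /andP[_ lein]|].
    rewrite h ?(ltnW lein)// nth_rcons size_map size_iota subn1 /= (lein : (i < n)%N).
    by rewrite (nth_map 0%N) ?size_iota ?subn1// nth_iota ?subn1.
  by rewrite h// nth_rcons size_map size_iota subn1 /= ltnn eqxx.
move=> i; rewrite ltnS leq_eqVlt nth_rcons size_map size_iota subn1 /=.
case: h => ha hk /orP[/eqP ->|lein]; first by rewrite ltnn eqxx.
rewrite lein (nth_map 0%N) ?size_iota ?subn1// nth_iota ?subn1//.
by rewrite ha.
Qed.

Lemma prob_first_below (a : nat -> nat) n : (0 < n)%N ->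
  P [set t | first_below (fun i => X i t) a n] =
  \sum_(0 <= k < a n) fidi_prob X (rcons [seq a i | i <- index_iota 1 n] k).
Proof.
move=> n0; under eq_bigr do rewrite fidi_prob_rcons//.
(* Fixing the value of [X n] makes these events pairwise disjoint; those with [k < a n] make up the
   departure at [n]. *)
pose F k := [set t | (forall i, (0 < i < n)%N -> X i t = a i) /\ X n t = k].
rewrite big_mkord -(measure_bigsetU P (F := F)).
- congr (P _); rewrite -(bigcup_mkord _ F); apply/seteqP; split=> t /=.
    by case=> _ agree lt; exists (X n t).
  by case=> k /= lt [agree eqk]; split=> //; rewrite eqk.
- move=> k; rewrite (_ : F k =
      [set t | forall i, (0 < i < n)%N -> X i t = a i] `&` [set t | [set k] (X n t)])//.
  by apply: measurableI; [exact: measurable_agree|exact: measurable_RV_preimage].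
- by move=> j k _ _ [t [[_ <-] [_ <-]]].
Qed.

End process.

(** * Point configurations for [q = 2], and the two formulas *)

Lemma config_upto_eqP (a b : nat -> nat) n : digits 2 a -> digits 2 b ->
  config_upto (point_configuration b) n = config_upto (point_configuration a) n
  <-> forall i, (0 < i < n.+1)%N -> b i = a i.
Proof.
move=> ha hb; split=> [/seteqP[ba ab] i /andP[i0 ilen]|agree].
  have := ha i i0; have := hb i i0.
  have := ba i; have := ab i; rewrite /config_upto /point_configuration /=.
  rewrite i0 -ltnS ilen.
  (* Both digits are 0 or 1; if they differ, one of the two inclusions puts [i] in the configuration
     whose digit is 0. *)
  by case: (a i) (b i) => [|[|//]] [|[|//]] // ab' ba' _ _;
    [have [[]] := ba' (conj (conj isT erefl) isT)
    |have [[]] := ab' (conj (conj isT erefl) isT)].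
by apply/seteqP; split=> i [[i0 bi] ilen]; split=> //; split=> //;
  rewrite -bi agree// i0; case/andP: ilen.
Qed.

Theorem proposition2p1 (d : measure_display) (T : measurableType d)
    (R : realType) (P : probability T R) (q : nat) (hq : (2 <= q)%N)
    (X : nat -> {RV P >-> nat}) (hX : forall t, digits q (fun n => X n t))
    (x : R) (hx : (0 <= x <= 1)%R) (a : nat -> nat) (ha : digits q a)
    (hxa : x = expansion_value R q a)
    (hnt : x \in base_fractions R q -> ~ terminating a) :
  process_cdf X q x =
    \sum_(1 <= n <oo | (1 <= a n)%N)
      \sum_(0 <= k < a n) fidi_prob X (rcons [seq a i | i <- index_iota 1 n] k)
    + P [set t | process_value X q t = x]
  /\
  (q = 2%N ->
   let y := point_configuration a in
   let Y t := point_configuration (fun n => X n t) in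
   process_cdf X q x =
     \esum_(n in y)
       P [set t | config_upto (Y t) n.-1 = config_upto y n.-1 /\ ~ Y t n]
     + P [set t | process_value X q t = x]).
Proof.
(* A terminating expansion with a nonzero digit represents a base-[q] fraction, which [hnt]
   excludes; only the zero sequence is left. *)
have hnt' : terminating a -> forall n, (0 < n)%N -> a n = 0%N.
  move=> ta n n0; apply: contrapT => /eqP an.
  apply: hnt (ta); rewrite hxa; apply: terminating_base_fraction => //.
  by exists n.
rewrite hxa process_cdfE//; split.
  congr (_ + _); rewrite eseries_cond nneseries_esum.
    by apply: eq_esum => n /andP[_ n0]; exact: prob_first_below.
  by move=> n _; apply: sume_ge0 => k _; exact: measure_ge0.
move=> q2 y Y; rewrite {}q2 in hX ha *; congr (_ + _).
(* A nonzero binary digit is 1. *)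
have -> : [set n | (1 <= a n)%N && (1 <= n)%N] = y.
  apply/seteqP; split=> n /=; last by case=> n0 ->; rewrite n0.
  by case/andP=> an n0; split=> //; have := ha n n0; lia.
apply: eq_esum => n [n0 an]; congr (P _); apply/seteqP; split=> t /=.
  case=> _ agree lt; split; first by apply/config_upto_eqP; rewrite ?prednK.
  by case=> _ Xn; rewrite Xn an in lt.
(* Since [n > 0], agreement up to [n.-1] is agreement before [n]; there [n] outside [Y t] forces the
   digit 0, below [a n = 1]. *)
case=> /config_upto_eqP; rewrite prednK// => agree nY; split=> //.
  exact: agree.
rewrite an ltnS leqNgt; apply/negP => X0; apply: nY; split=> //.
by have := hX t n n0; lia.
Qed.
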